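(* Let $f(z)=z+a_2z^2+a_3z^3+\cdots$ belong to the class $R$. Then $$|H_3(1)|\leq\frac{993}{1620}.$$
   Context: Let $E=\{z\in\mathbb{C}:|z|<1\}$ be the open unit disk and let $A$ be the class of functions $f(z)=z+a_2z^2+a_3z^3+\cdots$ analytic in $E$. The class $R$ of functions of bounded turning consists of all $f\in A$ such that $\operatorname{Re} f'(z)>0$ for all $z\in E$. For $f\in A$, with $a_1=1$, the Hankel determinant $H_3(1)$ is $$H_3(1)=\begin{vmatrix} a_1 & a_2 & a_3\\ a_2 & a_3 & a_4\\ a_3 & a_4 & a_5\end{vmatrix}=a_3(a_2a_4-a_3^2)-a_4(a_4-a_2a_3)+a_5(a_3-a_2^2).$$ *)

(* Defs.v *)
From Stdlib Require Import Reals.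
From Coquelicot Require Import Coquelicot.

Open Scope R_scope.

Definition unit_disk (z : C) : Prop := Cmod z < 1.

(* Analyticity in the open disk as complex differentiability at each point:
   here [ex_derive] is taken over the field C, not over R. *)
Definition analytic_in_disk (f : C -> C) : Prop :=
  forall z : C, unit_disk z -> @ex_derive C_AbsRing C_NormedModule f z.

(* f(z) = z + a_2 z^2 + a_3 z^3 + ... for every z in the disk. *)
Definition normalized_expansion (f : C -> C) (a : nat -> C) : Prop :=
  a 0%nat = RtoC 0 /\ a 1%nat = RtoC 1 /\
  forall z : C, unit_disk z -> @is_pseries C_AbsRing C_NormedModule a z (f z).

Definition class_A (f : C -> C) : Prop :=
  analytic_in_disk f /\ exists a : nat -> C, normalized_expansion f a.

(* [C_derive] differentiates along the real direction only; it is the complex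
   derivative here because members of [class_A] are complex differentiable in
   the disk (see [is_C_derive_unique]). *)
Definition class_R (f : C -> C) : Prop :=
  class_A f /\ forall z : C, unit_disk z -> 0 < Re (C_derive f z).

Definition det3 (m11 m12 m13 m21 m22 m23 m31 m32 m33 : C) : C :=
  (m11 * (m22 * m33 - m23 * m32)
   - m12 * (m21 * m33 - m23 * m31)
   + m13 * (m21 * m32 - m22 * m31))%C.

Definition hankel_3_1 (a : nat -> C) : C :=
  det3 (a 1%nat) (a 2%nat) (a 3%nat)
       (a 2%nat) (a 3%nat) (a 4%nat)
       (a 3%nat) (a 4%nat) (a 5%nat).

(* Main.v *)
Require Import Defs.
From Stdlib Require Import Reals Lra Lia ZArith.
From Coquelicot Require Import Coquelicot.

(** The determinant is a polynomial in the coefficients of [f'], a function of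
    positive real part with value [1] at the origin. Writing
    [f' = 1 + 2 b_1 z + 2 b_2 z^2 + ...], all the information used is that the
    Toeplitz form of such a function is positive semidefinite. Restricted to the
    frequencies [0], [i], [i + k] it gives (lemma [caratheodory_minor_bound])
<<
      |b_(i+k) - b_i b_k|^2 <= (1 - |b_i|^2) (1 - |b_k|^2).
>>
    With [e2 = b_2 - b_1^2], [e3 = b_3 - b_1 b_2] and [e4 = b_4 - b_2^2] one has
    the identity ([hankel_decomposition])
<<
      H = 4/15 (e2 - b_1^2 / 2) e4 - e3^2 / 4 + b_1 b_2 e3 / 6
          + (b_1 b_2)^2 / 60 - 4/135 b_2^3.
>>
    The minors for [(i, k)] equal to [(1, 1)], [(1, 2)] and [(2, 2)] bound the
    three defects. With [x = |b_1|] and [y = |b_2|], the first factor is at most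
    [(1 - x^2) + x^2 / 2 <= 1], both [|e4|] and [|e3|^2] are at most [1 - y^2],
    and [2 x y |e3| <= x^2 y^2 + |e3|^2]. The triangle inequality then gives
    [|H| <= 3/5 (1 - y^2) + 7/54 y^2 <= 3/5], which is below [993 / 1620].

    Positivity of the form ([toeplitz_form_ge0]) is obtained by averaging against
    the square modulus of a trigonometric polynomial. Since [Re f' > 0],
    [Re ((f (r w) - f (s w)) / w)] is nonnegative for [|w| = 1] and [s < r]
    ([radial_increase]). Its weighted mean over the [N]-th roots of unity tends,
    as [N] grows, to the form in the coefficients [a_j (r^j - s^j)]; dividing by
    [r - s] and letting both radii tend to [1] yields the coefficients [j a_j] of
    [f']. *)

(** * Finite sums and limits of complex sequences *)

Fixpoint Csum (g : nat -> C) (n : nat) : C :=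
  match n with
  | O => 0
  | S n' => (Csum g n' + g n')%C
  end.

Lemma Csum_ext (g h : nat -> C) (n : nat) :
  (forall k, (k < n)%nat -> g k = h k) -> Csum g n = Csum h n.
Proof.
  induction n as [|n IH]; intros E; simpl; [easy|].
  rewrite IH by (intros; apply E; lia). now rewrite E by lia.
Qed.

Lemma Csum_plus (g h : nat -> C) (n : nat) :
  Csum (fun k => g k + h k)%C n = (Csum g n + Csum h n)%C.
Proof. induction n as [|n IH]; simpl; [ring|rewrite IH; ring]. Qed.

Lemma Csum_scal (c : C) (g : nat -> C) (n : nat) :
  Csum (fun k => c * g k)%C n = (c * Csum g n)%C.
Proof. induction n as [|n IH]; simpl; [ring|rewrite IH; ring]. Qed.

Lemma Csum_const (c : C) (n : nat) : Csum (fun _ => c) n = (INR n * c)%C.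
Proof.
  induction n as [|n IH]; [simpl; ring|].
  change (Csum (fun _ => c) (S n)) with (Csum (fun _ => c) n + c)%C.
  rewrite IH, S_INR, RtoC_plus. ring.
Qed.

Lemma Csum_conj (g : nat -> C) (n : nat) :
  Cconj (Csum g n) = Csum (fun k => Cconj (g k)) n.
Proof.
  induction n as [|n IH]; simpl.
  - apply injective_projections; simpl; lra.
  - now rewrite Cplus_conj, IH.
Qed.

Lemma Csum_exchange (g : nat -> nat -> C) (n m : nat) :
  Csum (fun j => Csum (g j) m) n = Csum (fun k => Csum (fun j => g j k) n) m.
Proof.
  induction n as [|n IH]; simpl.
  - rewrite Csum_const. ring.
  - now rewrite IH, Csum_plus.
Qed.

Lemma Cmod_Csum_le (g : nat -> C) (e : R) (n : nat) :
  (forall k, (k < n)%nat -> Cmod (g k) <= e) -> Cmod (Csum g n) <= INR n * e.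
Proof.
  induction n as [|n IH]; intros H.
  - simpl. rewrite Cmod_0. lra.
  - rewrite S_INR. cbn [Csum].
    apply Rle_trans with (1 := Cmod_triangle _ _).
    specialize (IH ltac:(intros; apply H; lia)). specialize (H n ltac:(lia)). lra.
Qed.

Lemma Re_Csum_ge0 (g : nat -> C) (n : nat) :
  (forall k, (k < n)%nat -> 0 <= Re (g k)) -> 0 <= Re (Csum g n).
Proof.
  induction n as [|n IH]; intros H; cbn [Csum].
  - simpl; lra.
  - specialize (IH ltac:(intros; apply H; lia)). specialize (H n ltac:(lia)).
    unfold Re in *. simpl. lra.
Qed.

(** Convergence is phrased through the real sequence of distances, so that
    the triangle inequality and the real squeeze theorem do all the work. *)
Definition Ccv (u : nat -> C) (l : C) : Prop :=
  is_lim_seq (fun N => Cmod (u N - l)) 0.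

Lemma is_lim_seq_dominated (u v : nat -> R) :
  (forall n, 0 <= u n <= v n) -> is_lim_seq v 0 -> is_lim_seq u 0.
Proof.
  intros H Hv. apply is_lim_seq_le_le with (fun _ => 0) v; trivial.
  apply is_lim_seq_const.
Qed.

Lemma Ccv_const (l : C) : Ccv (fun _ => l) l.
Proof.
  unfold Ccv. apply is_lim_seq_ext with (fun _ => 0); [|apply is_lim_seq_const].
  intros _. replace (l - l)%C with (RtoC 0) by ring. now rewrite Cmod_0.
Qed.

Lemma Ccv_ext (u v : nat -> C) (l : C) :
  (forall n, u n = v n) -> Ccv u l -> Ccv v l.
Proof. intros E. apply is_lim_seq_ext. intros n. now rewrite E. Qed.

Lemma Ccv_plus (u v : nat -> C) (l m : C) :
  Ccv u l -> Ccv v m -> Ccv (fun n => u n + v n)%C (l + m)%C.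
Proof.
  intros Hu Hv.
  apply is_lim_seq_dominated with (fun n => Cmod (u n - l) + Cmod (v n - m)).
  - intros n. split; [apply Cmod_ge_0|].
    replace (u n + v n - (l + m))%C with ((u n - l) + (v n - m))%C by ring.
    apply Cmod_triangle.
  - replace 0 with (0 + 0) by lra. now apply is_lim_seq_plus'.
Qed.

Lemma Ccv_scal (c : C) (u : nat -> C) (l : C) :
  Ccv u l -> Ccv (fun n => c * u n)%C (c * l)%C.
Proof.
  intros Hu. unfold Ccv.
  apply is_lim_seq_ext with (fun n => Cmod c * Cmod (u n - l)).
  - intros n. rewrite <- Cmod_mult. f_equal. ring.
  - replace 0 with (Cmod c * 0) by lra. now apply is_lim_seq_mult';
    [apply is_lim_seq_const|].
Qed.

Lemma Ccv_Csum (u : nat -> nat -> C) (l : nat -> C) (n : nat) :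
  (forall k, (k < n)%nat -> Ccv (fun N => u N k) (l k)) ->
  Ccv (fun N => Csum (u N) n) (Csum l n).
Proof.
  induction n as [|n IH]; intros H; simpl.
  - apply Ccv_const.
  - apply Ccv_plus; [apply IH; intros|]; apply H; lia.
Qed.

Lemma Ccv_RtoC (u : nat -> R) (l : R) : is_lim_seq u l -> Ccv (fun n => RtoC (u n)) l.
Proof.
  intros H. unfold Ccv.
  apply is_lim_seq_ext with (fun n => Rabs (u n - l)).
  - intros n. now rewrite <- RtoC_minus, Cmod_R.
  - apply is_lim_seq_spec in H. apply is_lim_seq_spec. intros e.
    destruct (H e) as [N HN]. exists N. intros n Hn.
    rewrite Rminus_0_r, Rabs_Rabsolu. now apply HN.
Qed.

Lemma Ccv_Re_ge0 (u : nat -> C) (l : C) :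
  Ccv u l -> eventually (fun n => 0 <= Re (u n)) -> 0 <= Re l.
Proof.
  intros H [N0 HN0]. apply Rnot_lt_le. intros Hl.
  apply is_lim_seq_spec in H.
  destruct (H (mkposreal (- Re l) ltac:(lra))) as [N HN]. simpl in HN.
  specialize (HN (max N N0) ltac:(lia)). specialize (HN0 (max N N0) ltac:(lia)).
  set (x := u (max N N0)) in *.
  rewrite Rminus_0_r, Rabs_pos_eq in HN by apply Cmod_ge_0.
  pose proof (re_le_Cmod (x - l)) as Hr. apply Rabs_le_between in Hr.
  unfold Re in *. simpl in *. lra.
Qed.

Lemma Ccv_eps (u : nat -> C) (l : C) :
  (forall e, 0 < e -> exists N0, forall N, (N0 <= N)%nat -> Cmod (u N - l) <= e) ->
  Ccv u l.
Proof.
  intros H. apply is_lim_seq_spec. intros e.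
  destruct (H (e / 2)) as [N0 HN0]; [destruct e; simpl; lra|].
  exists N0. intros N HN. specialize (HN0 N HN).
  rewrite Rminus_0_r, Rabs_pos_eq by apply Cmod_ge_0. destruct e; simpl in *; lra.
Qed.

Lemma Ccv_Cmod_le (u : nat -> C) (l c : C) (e : R) :
  Ccv u l -> eventually (fun n => Cmod (u n - c) <= e) -> Cmod (l - c) <= e.
Proof.
  intros H [N0 HN0]. apply Rnot_lt_le. intros Hl.
  apply is_lim_seq_spec in H.
  destruct (H (mkposreal (Cmod (l - c) - e) ltac:(lra))) as [N HN]. simpl in HN.
  specialize (HN (max N N0) ltac:(lia)). specialize (HN0 (max N N0) ltac:(lia)).
  set (x := u (max N N0)) in *.
  rewrite Rminus_0_r, Rabs_pos_eq in HN by apply Cmod_ge_0.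
  pose proof (Cmod_triangle (x - c) (- (x - l))) as Hr. rewrite Cmod_opp in Hr.
  replace ((x - c) + - (x - l))%C with (l - c)%C in Hr by ring. lra.
Qed.

(** * Means over roots of unity *)

Definition cis (t : R) : C := (cos t, sin t).

Lemma cis_0 : cis 0 = 1.
Proof. unfold cis. now rewrite cos_0, sin_0. Qed.

Lemma cis_plus (s t : R) : cis (s + t) = (cis s * cis t)%C.
Proof.
  unfold cis, Cmult. simpl. rewrite cos_plus, sin_plus. f_equal; ring.
Qed.

Lemma cis_conj (t : R) : Cconj (cis t) = cis (- t).
Proof. unfold cis, Cconj. simpl. now rewrite cos_neg, sin_neg. Qed.

Lemma Cmod_cis (t : R) : Cmod (cis t) = 1.
Proof.
  unfold Cmod, cis. simpl. replace (_ + _) with 1; [apply sqrt_1|].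
  pose proof (sin2_cos2 t) as H. unfold Rsqr in H. lra.
Qed.

Lemma cis_pow (t : R) (n : nat) : (cis t ^ n)%C = cis (INR n * t).
Proof.
  induction n as [|n IH].
  - simpl. now rewrite Rmult_0_l, cis_0.
  - rewrite Cpow_S, IH, S_INR, <- cis_plus. f_equal. ring.
Qed.

Lemma cis_2PI_Z (m : Z) : cis (IZR m * (2 * PI)) = 1.
Proof.
  unfold cis.
  replace (IZR m * (2 * PI)) with (2 * (IZR m * PI)) by ring.
  assert (Hs : sin (IZR m * PI) = 0) by (apply sin_eq_0_1; now exists m).
  rewrite cos_2a_sin, sin_2a, Hs. apply injective_projections; simpl; ring.
Qed.

(** By the half-angle formula, the value [1] forces
    [sin (m PI / N) = 0], so [N] divides [m]. *)
Lemma cis_root_neq_1 (N : nat) (m : Z) :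
  (0 < Z.abs m < Z.of_nat N)%Z -> cis (IZR m * (2 * PI / INR N)) <> 1.
Proof.
  intros Hm E.
  assert (HN : 0 < INR N) by (apply lt_0_INR; lia).
  assert (E1 : cos (IZR m * (2 * PI / INR N)) = 1) by (now injection E).
  replace (IZR m * (2 * PI / INR N)) with (2 * (IZR m * PI / INR N)) in E1
    by (field; lra).
  rewrite cos_2a_sin in E1.
  assert (E2 : sin (IZR m * PI / INR N) = 0)
    by (apply Rsqr_0_uniq; unfold Rsqr; lra).
  destruct (sin_eq_0_0 _ E2) as [k Hk].
  assert (E3 : IZR m = IZR k * INR N).
  { pose proof PI_RGT_0. apply Rmult_eq_reg_r with (PI / INR N).
    - transitivity (IZR m * PI / INR N); [field; lra|]. rewrite Hk. field; lra.
    - apply Rgt_not_eq. apply Rdiv_lt_0_compat; lra. }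
  rewrite INR_IZR_INZ, <- mult_IZR in E3. apply eq_IZR in E3.
  rewrite E3, Z.abs_mul in Hm.
  assert (Hk0 : (Z.abs k = 0 \/ 1 <= Z.abs k)%Z) by lia.
  destruct Hk0 as [Hk0|Hk0]; nia.
Qed.

(** The mean of [g] over the [N] equally spaced angles replaces the integral
    over the circle: for a trigonometric polynomial of degree below [N] the two
    agree, and a mean is still linear, monotone and bounded by the supremum. *)
Definition mean (N : nat) (g : R -> C) : C :=
  (/ INR N * Csum (fun k => g (INR k * (2 * PI / INR N))%R) N)%C.

Lemma RtoC_INR_neq0 (N : nat) : (0 < N)%nat -> RtoC (INR N) <> 0.
Proof. intros HN E. apply RtoC_inj in E. apply lt_0_INR in HN. lra. Qed.

Lemma mean_ext (N : nat) (g h : R -> C) :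
  (forall t, g t = h t) -> mean N g = mean N h.
Proof. intros E. unfold mean. f_equal. apply Csum_ext. intros; apply E. Qed.

Lemma mean_const (N : nat) (c : C) : (0 < N)%nat -> mean N (fun _ => c) = c.
Proof.
  intros HN. unfold mean. rewrite Csum_const. field. now apply RtoC_INR_neq0.
Qed.

Lemma mean_plus (N : nat) (g h : R -> C) :
  mean N (fun t => g t + h t)%C = (mean N g + mean N h)%C.
Proof. unfold mean. rewrite Csum_plus. ring. Qed.

Lemma mean_scal (N : nat) (c : C) (g : R -> C) :
  mean N (fun t => c * g t)%C = (c * mean N g)%C.
Proof. unfold mean. rewrite Csum_scal. ring. Qed.

Lemma mean_Csum (N n : nat) (g : nat -> R -> C) :
  mean N (fun t => Csum (fun j => g j t) n) = Csum (fun j => mean N (g j)) n.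
Proof. unfold mean. now rewrite Csum_exchange, Csum_scal. Qed.

Lemma Cmod_mean_le (N : nat) (g : R -> C) (e : R) :
  (0 < N)%nat -> (forall t, Cmod (g t) <= e) -> Cmod (mean N g) <= e.
Proof.
  intros HN H. assert (HN' := lt_0_INR _ HN). unfold mean.
  rewrite Cmod_mult, <- RtoC_inv by lra.
  rewrite Cmod_R, Rabs_pos_eq by (left; now apply Rinv_0_lt_compat).
  apply Rmult_le_reg_l with (INR N); trivial.
  rewrite <- Rmult_assoc, Rinv_r, Rmult_1_l by lra.
  apply Cmod_Csum_le. intros; apply H.
Qed.

Lemma Re_mean_ge0 (N : nat) (g : R -> C) :
  (0 < N)%nat -> (forall t, 0 <= Re (g t)) -> 0 <= Re (mean N g).
Proof.
  intros HN H. assert (HN' := lt_0_INR _ HN). unfold mean.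
  rewrite <- RtoC_inv by lra. rewrite re_scal_l.
  apply Rmult_le_pos; [left; now apply Rinv_0_lt_compat|].
  apply Re_Csum_ge0. intros; apply H.
Qed.

(** The sum is geometric, with ratio an [N]-th root of unity other than [1]. *)
Lemma mean_cis (N : nat) (m : Z) :
  (0 < Z.abs m < Z.of_nat N)%Z -> mean N (fun t => cis (IZR m * t)) = 0.
Proof.
  intros Hm. assert (HN : 0 < INR N) by (apply lt_0_INR; lia).
  unfold mean. set (w := cis (IZR m * (2 * PI / INR N))).
  assert (Hgeom : forall n, ((w - 1) * Csum (fun k => cis (IZR m * (INR k * (2 * PI / INR N)))) n
                   = w ^ n - 1)%C).
  { induction n as [|n IH]; cbn [Csum].
    - simpl. ring.
    - rewrite Cmult_plus_distr_l, IH, Cpow_S.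
      replace (cis _) with (w ^ n)%C; [ring|].
      unfold w. rewrite cis_pow. f_equal. ring. }
  assert (Hw : (w ^ N = 1)%C).
  { unfold w. rewrite cis_pow, <- (cis_2PI_Z m). f_equal. field. lra. }
  specialize (Hgeom N). rewrite Hw in Hgeom.
  assert (Hw1 : (w - 1 <> 0)%C).
  { apply Cminus_eq_contra. now apply cis_root_neq_1. }
  assert (E : forall x : C, ((w - 1) * x = 1 - 1)%C -> x = 0).
  { intros x Hx. replace x with (/ (w - 1) * ((w - 1) * x))%C by (field; easy).
    rewrite Hx. ring. }
  rewrite (E _ Hgeom). ring.
Qed.

(** Frequencies range over [Z], since the weights below contain negative ones;
    an analytic function has no Fourier coefficient there. *)
Definition Zcoef (b : nat -> C) (m : Z) : C :=
  if Z.ltb m 0 then 0 else b (Z.to_nat m).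

(** Orthogonality: as soon as no two frequencies in play coincide modulo [N],
    the mean picks out a single coefficient without aliasing. *)
Lemma mean_trig_poly (N M : nat) (b : nat -> C) (m : Z) :
  (Z.of_nat M + Z.abs m < Z.of_nat N)%Z ->
  mean N (fun t => Csum (fun j => b j * cis (IZR (Z.of_nat j - m) * t))%C M)
  = if Z.ltb m (Z.of_nat M) then Zcoef b m else 0.
Proof.
  intros HN. rewrite mean_Csum.
  assert (Hj : forall j, (j < M)%nat ->
    mean N (fun t => b j * cis (IZR (Z.of_nat j - m) * t))%C
    = if Z.eqb (Z.of_nat j) m then b j else 0).
  { intros j Hj. rewrite mean_scal. destruct (Z.eqb_spec (Z.of_nat j) m) as [E|E].
    - rewrite (mean_ext _ _ (fun _ => RtoC 1)).
      + rewrite mean_const by lia. ring.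
      + intros t. replace (Z.of_nat j - m)%Z with 0%Z by lia.
        now rewrite Rmult_0_l, cis_0.
    - rewrite mean_cis by lia. ring. }
  rewrite (Csum_ext _ _ _ Hj). clear Hj HN.
  induction M as [|M IH]; cbn [Csum].
  - unfold Zcoef. now destruct (Z.ltb_spec m (Z.of_nat 0)), (Z.ltb_spec m 0); try lia.
  - rewrite IH. unfold Zcoef.
    destruct (Z.ltb_spec m (Z.of_nat M)), (Z.ltb_spec m (Z.of_nat (S M))),
      (Z.eqb_spec (Z.of_nat M) m), (Z.ltb_spec m 0); try lia; try ring.
    replace (Z.to_nat m) with M by lia. ring.
Qed.

(** * Fourier coefficients of a power series on a circle *)

Lemma is_pseries_Ccv (a : nat -> C) (z l : C) :
  @is_pseries C_AbsRing C_NormedModule a z l ->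
  Ccv (Csum (fun j => a j * z ^ j)%C) l.
Proof.
  intros H. apply is_lim_seq_incr_1.
  assert (Hs : forall n,
    sum_n (fun k => @scal C_AbsRing C_NormedModule (pow_n (z : C_AbsRing) k) (a k)) n
    = Csum (fun j => a j * z ^ j)%C (S n)).
  { assert (Hp : forall k, pow_n (z : C_AbsRing) k = (z ^ k)%C).
    { induction k as [|k IH]; [easy|]. cbn [pow_n]. rewrite IH. easy. }
    induction n as [|n IH].
    - rewrite sum_O, Hp. change (1 * a O = 0 + a O * 1)%C. ring.
    - rewrite sum_Sn, IH, Hp.
      change (Csum (fun j => a j * z ^ j)%C (S n) + z ^ S n * a (S n)
        = Csum (fun j => a j * z ^ j) (S n) + a (S n) * z ^ S n)%C. ring. }
  apply Ccv_eps. intros e He.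
  assert (Hl := proj1 (filterlim_locally_ball_norm _ _) H (mkposreal e He)).
  destruct Hl as [N HN]. exists N. intros n Hn. specialize (HN n Hn).
  unfold ball_norm in HN. rewrite Hs in HN.
  left. exact HN.
Qed.

Lemma geometric_tail (b : nat -> C) (K t : R) (M k : nat) :
  0 <= t < 1 -> (forall j, Cmod (b j) <= K * t ^ j) ->
  Cmod (Csum b (M + k) - Csum b M) <= K / (1 - t) * (t ^ M - t ^ (M + k)).
Proof.
  intros Ht Hb. induction k as [|k IH].
  - rewrite Nat.add_0_r. replace (_ - _)%C with (RtoC 0) by ring.
    rewrite Cmod_0. lra.
  - rewrite Nat.add_succ_r. cbn [Csum].
    replace (_ - _)%C with ((Csum b (M + k) - Csum b M) + b (M + k)%nat)%C by ring.
    apply Rle_trans with (1 := Cmod_triangle _ _).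
    specialize (Hb (M + k)%nat). simpl.
    replace (K / (1 - t) * (t ^ M - t * t ^ (M + k))) with
      (K / (1 - t) * (t ^ M - t ^ (M + k)) + K * t ^ (M + k)) by (field; lra).
    lra.
Qed.

(** Convergence at the larger radius [(1 + rho) / 2] bounds
    [Cmod (a j) * rho' ^ j], so on the smaller disk the series is dominated by a
    geometric one. *)
Lemma partial_sums_uniform (f : C -> C) (a : nat -> C) (rho e : R) :
  (forall z, unit_disk z -> @is_pseries C_AbsRing C_NormedModule a z (f z)) ->
  0 <= rho < 1 -> 0 < e ->
  exists M0, forall M, (M0 <= M)%nat -> forall z, Cmod z <= rho ->
    Cmod (f z - Csum (fun j => a j * z ^ j)%C M) <= e.
Proof.
  intros Ha Hrho He.
  set (rho' := (1 + rho) / 2). assert (Hr' : rho < rho' < 1 /\ 0 < rho') by (unfold rho'; lra).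
  assert (HK : exists K, 0 <= K /\ forall j, Cmod (a j) * rho' ^ j <= K).
  { assert (Hd : unit_disk rho') by (red; rewrite Cmod_R, Rabs_pos_eq; lra).
    assert (Hc := is_pseries_Ccv _ _ _ (Ha _ Hd)). red in Hc.
    destruct (@filterlim_bounded R_AbsRing R_NormedModule _
      (ex_intro _ (0 : R_NormedModule) Hc)) as [B HB].
    assert (HB' : forall n, Cmod (Csum (fun j => a j * rho' ^ j)%C n - f rho') <= B).
    { intros n. apply Rle_trans with (2 := HB n). apply Rle_abs. }
    exists (B + B). split.
    - pose proof (HB' O) as H0. pose proof (Cmod_ge_0 (Csum (fun j => a j * rho' ^ j)%C 0 - f rho')). lra.
    - intros j. rewrite <- (Rabs_pos_eq rho') by lra.
      rewrite <- Cmod_R, <- Cmod_pow, <- Cmod_mult.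
      replace (a j * rho' ^ j)%C with
        ((Csum (fun j => a j * rho' ^ j)%C (S j) - f rho')
         + - (Csum (fun j => a j * rho' ^ j)%C j - f rho'))%C by (cbn [Csum]; ring).
      apply Rle_trans with (1 := Cmod_triangle _ _). rewrite Cmod_opp.
      pose proof (HB' j). pose proof (HB' (S j)). lra. }
  destruct HK as [K [HK0 HK]].
  set (t := rho / rho').
  assert (Ht : 0 <= t < 1).
  { unfold t. split; [apply Rdiv_le_0_compat; lra|].
    apply Rmult_lt_reg_r with rho'; [lra|]. unfold Rdiv.
    rewrite Rmult_assoc, Rinv_l; lra. }
  assert (Hterm : forall z, Cmod z <= rho -> forall j, Cmod (a j * z ^ j) <= K * t ^ j).
  { intros z Hz j. rewrite Cmod_mult, Cmod_pow.
    apply Rle_trans with (Cmod (a j) * rho ^ j).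
    - apply Rmult_le_compat_l; [apply Cmod_ge_0|]. apply pow_incr. split; [apply Cmod_ge_0|easy].
    - replace rho with (rho' * t) at 1 by (unfold t; field; lra).
      rewrite Rpow_mult_distr, <- Rmult_assoc.
      apply Rmult_le_compat_r; [apply pow_le; lra|apply HK]. }
  assert (Hq : 0 <= K / (1 - t)) by (apply Rdiv_le_0_compat; lra).
  destruct (pow_lt_1_zero t ltac:(rewrite Rabs_pos_eq; lra) (e / (K / (1 - t) + 1)))
    as [M0 HM0].
  { apply Rdiv_lt_0_compat; lra. }
  exists M0. intros M HM z Hz.
  apply Ccv_Cmod_le with (Csum (fun j => a j * z ^ j)%C).
  - apply is_pseries_Ccv, Ha. red. lra.
  - exists M. intros n Hn. replace n with (M + (n - M))%nat by lia.
    apply Rle_trans with (1 := geometric_tail _ _ _ _ _ Ht (Hterm z Hz)).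
    specialize (HM0 M HM). rewrite Rabs_pos_eq in HM0 by (apply pow_le; lra).
    assert (Hp : 0 <= t ^ (M + (n - M))) by (apply pow_le; lra).
    assert (HtM : 0 <= t ^ M) by (apply pow_le; lra).
    apply Rle_trans with ((K / (1 - t) + 1) * t ^ M); [nra|].
    replace e with ((K / (1 - t) + 1) * (e / (K / (1 - t) + 1))) by (field; lra).
    apply Rmult_le_compat_l; lra.
Qed.

(** A partial sum contributes its exact coefficient once [N] exceeds all
    frequencies, and the uniformly small remainder has a small mean. *)
Lemma mean_tends_to_coefficient (f : C -> C) (a : nat -> C) (r : R) (m : Z) :
  (forall z, unit_disk z -> @is_pseries C_AbsRing C_NormedModule a z (f z)) ->
  0 <= r < 1 ->
  Ccv (fun N => mean (S N) (fun t => f (r * cis t) * cis (- IZR m * t))%C)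
    (Zcoef (fun j => a j * r ^ j)%C m).
Proof.
  intros Ha Hr. apply Ccv_eps. intros e He.
  destruct (partial_sums_uniform f a r e Ha Hr He) as [M0 HM0].
  set (M := max M0 (S (Z.abs_nat m))).
  exists (M + Z.abs_nat m)%nat. intros N HN.
  rewrite (mean_ext _ _ (fun t =>
    Csum (fun j => a j * r ^ j * cis (IZR (Z.of_nat j - m) * t))%C M
    + (f (r * cis t) - Csum (fun j => a j * (r * cis t) ^ j) M) * cis (- IZR m * t))%C).
  - rewrite mean_plus, mean_trig_poly by lia.
    destruct (Z.ltb_spec m (Z.of_nat M)) as [_|Hm]; [|lia].
    match goal with |- Cmod (?x + ?y - ?x) <= _ => replace (x + y - x)%C with y by ring end.
    apply Cmod_mean_le; [lia|]. intros t.
    rewrite Cmod_mult, Cmod_cis, Rmult_1_r. apply HM0; [lia|].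
    rewrite Cmod_mult, Cmod_cis, Cmod_R, Rabs_pos_eq; lra.
  - intros t.
    assert (E : (Csum (fun j => a j * (r * cis t) ^ j) M * cis (- IZR m * t)
      = Csum (fun j => a j * r ^ j * cis (IZR (Z.of_nat j - m) * t)) M)%C).
    { rewrite Cmult_comm, <- Csum_scal. apply Csum_ext. intros j _.
      rewrite Cpow_mult_l, cis_pow.
      replace (IZR (Z.of_nat j - m) * t) with (INR j * t + - IZR m * t)
        by (rewrite minus_IZR, <- INR_IZR_INZ; ring).
      rewrite cis_plus. ring. }
    rewrite <- E. ring.
Qed.

(** * Positivity of the Toeplitz form *)

Lemma radial_derivative (f : C -> C) (theta x : R) (l : C) :
  @is_derive C_AbsRing C_NormedModule f (x * cis theta)%C l ->
  is_derive (fun y : R => Re (f (y * cis theta) * cis (- theta))%C) x (Re l).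
Proof.
  intros [_ H]. specialize (H _ (fun P HP => HP)).
  apply is_derive_Reals. intros e He.
  destruct (H (mkposreal (e / 2) ltac:(lra))) as [d Hd]. exists d. intros h Hh0 Hh.
  set (z := (x * cis theta)%C) in *. set (y := ((x + h)%R * cis theta)%C).
  assert (Ey : (y - z = h * cis theta)%C) by (unfold y, z; rewrite RtoC_plus; ring).
  assert (Hm : Cmod (y - z) = Rabs h) by (now rewrite Ey, Cmod_mult, Cmod_cis, Cmod_R, Rmult_1_r).
  assert (Hy : Cmod (f y - f z - (y - z) * l)%C <= e / 2 * Cmod (y - z)).
  { apply Hd. change (Cmod (y - z) < d). now rewrite Hm. }
  rewrite Hm, Ey in Hy.
  assert (Hcc : (cis theta * cis (- theta) = 1)%C)
    by (rewrite <- cis_plus, Rplus_opp_r; apply cis_0).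
  assert (E : (Re (f y * cis (- theta)) - Re (f z * cis (- theta))) / h - Re l
    = Re ((f y - f z - h * cis theta * l) * cis (- theta)) / h).
  { replace ((f y - f z - h * cis theta * l) * cis (- theta))%C with
      (f y * cis (- theta) - f z * cis (- theta) - h * ((cis theta * cis (- theta)) * l))%C
      by ring.
    rewrite Hcc, Cmult_1_l.
    transitivity ((Re (f y * cis (- theta)) - Re (f z * cis (- theta)) - Re (h * l)) / h).
    - rewrite re_scal_l. field. easy.
    - f_equal. }
  unfold C in *. fold y. rewrite E.
  assert (Hpos := Rabs_pos_lt _ Hh0).
  unfold Rdiv at 1. rewrite Rabs_mult, Rabs_inv.
  apply Rmult_lt_reg_r with (Rabs h); [easy|].
  rewrite Rmult_assoc, Rinv_l, Rmult_1_r by lra.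
  apply Rle_lt_trans with (1 := re_le_Cmod _).
  rewrite Cmod_mult, Cmod_cis, Rmult_1_r.
  apply Rle_lt_trans with (1 := Hy). nra.
Qed.

(** Along a radius, [Re (f z * exp (- i theta))] has derivative [Re (f' z) > 0].
    Increments of [f] are used in place of [f'] because they are power series
    with known coefficients, so no term-by-term differentiation is involved. *)
Lemma radial_increase (f : C -> C) (theta s r : R) :
  class_R f -> 0 <= s < r -> r < 1 ->
  0 <= Re ((f (r * cis theta) - f (s * cis theta)) * cis (- theta))%C.
Proof.
  intros [[Hd _] Hpos] Hs Hr.
  assert (Hdisk : forall x, s <= x <= r -> unit_disk (x * cis theta)).
  { intros x Hx. red. rewrite Cmod_mult, Cmod_cis, Cmod_R, Rabs_pos_eq; lra. }
  assert (H : Re (f (s * cis theta) * cis (- theta))%C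
    < Re (f (r * cis theta) * cis (- theta))%C).
  { apply (incr_function_le (fun y : R => Re (f (y * cis theta) * cis (- theta))%C)
      s r (fun x => Re (C_derive f (x * cis theta)))); cbn [Rbar_le]; try lra.
    - intros x Hx1 Hx2. apply radial_derivative.
      destruct (Hd _ (Hdisk x (conj Hx1 Hx2))) as [l Hl].
      now rewrite (is_C_derive_unique _ _ _ Hl).
    - intros x Hx1 Hx2. apply Hpos, Hdisk. lra. }
  replace ((f (r * cis theta) - f (s * cis theta)) * cis (- theta))%C with
    (f (r * cis theta) * cis (- theta) - f (s * cis theta) * cis (- theta))%C by ring.
  unfold Re in *. simpl in *. lra.
Qed.

Definition sesqui (n : nat) (lam : nat -> C) (c : nat -> nat -> C) : C :=
  Csum (fun x => Csum (fun y => lam x * Cconj (lam y) * c x y)%C n) n.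

Lemma Ccv_sesqui (n : nat) (lam : nat -> C) (u : nat -> nat -> nat -> C)
    (c : nat -> nat -> C) :
  (forall x y, Ccv (fun N => u N x y) (c x y)) ->
  Ccv (fun N => sesqui n lam (u N)) (sesqui n lam c).
Proof.
  intros H. unfold sesqui.
  apply (Ccv_Csum (fun N x => Csum (fun y => lam x * Cconj (lam y) * u N x y)%C n)).
  intros x _.
  apply (Ccv_Csum (fun N y => lam x * Cconj (lam y) * u N x y)%C).
  intros y _. apply Ccv_scal, H.
Qed.

Lemma sesqui_scal (n : nat) (lam : nat -> C) (k : C) (c : nat -> nat -> C) :
  sesqui n lam (fun x y => k * c x y)%C = (k * sesqui n lam c)%C.
Proof.
  unfold sesqui. rewrite <- Csum_scal. apply Csum_ext. intros x _.
  rewrite <- Csum_scal. apply Csum_ext. intros y _. ring.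
Qed.

(** Weighting by the square modulus of the trigonometric polynomial with
    coefficients [lam] and frequencies [d] turns a mean of [F] into a form in the
    Fourier coefficients of [F]. *)
Lemma mean_square_weight (N n : nat) (lam : nat -> C) (d : nat -> Z) (F : R -> C) :
  mean N (fun t => F t *
    (Csum (fun x => lam x * cis (IZR (d x) * t)) n
     * Cconj (Csum (fun x => lam x * cis (IZR (d x) * t)) n)))%C
  = sesqui n lam (fun x y => mean N (fun t => F t * cis (- IZR (d y - d x) * t))%C).
Proof.
  unfold sesqui.
  rewrite (mean_ext _ _ (fun t => Csum (fun x => Csum (fun y =>
    lam x * Cconj (lam y) * (F t * cis (- IZR (d y - d x) * t)))%C n) n)).
  - rewrite (mean_Csum N n (fun x t => Csum (fun y =>
      lam x * Cconj (lam y) * (F t * cis (- IZR (d y - d x) * t)))%C n)).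
    apply Csum_ext. intros x _.
    rewrite (mean_Csum N n (fun y t =>
      lam x * Cconj (lam y) * (F t * cis (- IZR (d y - d x) * t)))%C).
    apply Csum_ext. intros y _. apply mean_scal.
  - intros t. rewrite Csum_conj.
    set (Q := Csum (fun k => Cconj (lam k * cis (IZR (d k) * t))%C) n).
    transitivity (Csum (fun x => (F t * Q) * (lam x * cis (IZR (d x) * t)))%C n).
    { rewrite Csum_scal. ring. }
    apply Csum_ext. intros x _.
    transitivity (F t * (lam x * cis (IZR (d x) * t)) * Q)%C; [ring|].
    unfold Q. rewrite <- Csum_scal. apply Csum_ext. intros y _.
    rewrite Cmult_conj, cis_conj.
    replace (- IZR (d y - d x) * t) with (IZR (d x) * t + - (IZR (d y) * t))
      by (rewrite minus_IZR; ring).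
    rewrite cis_plus. ring.
Qed.

(** The mean of [Re F >= 0] against a nonnegative weight is nonnegative, where
    [F] is the rotated radial increment of [f]; let the number of sample points
    tend to infinity. The shift by [1] in the index comes from the rotation
    factor [cis (- t)]. *)
Lemma difference_form_ge0 (f : C -> C) (a : nat -> C) (s r : R)
    (n : nat) (lam : nat -> C) (d : nat -> Z) :
  class_R f ->
  (forall z, unit_disk z -> @is_pseries C_AbsRing C_NormedModule a z (f z)) ->
  0 <= s < r -> r < 1 ->
  0 <= Re (sesqui n lam (fun x y =>
    Zcoef (fun j => a j * r ^ j)%C (d y - d x + 1)
    - Zcoef (fun j => a j * s ^ j)%C (d y - d x + 1))%C).
Proof.
  intros Hf Ha Hs Hr.
  set (F := fun t => ((f (r * cis t) - f (s * cis t)) * cis (- t))%C).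
  apply Ccv_Re_ge0 with (fun N => sesqui n lam (fun x y =>
    mean (S N) (fun t => F t * cis (- IZR (d y - d x) * t))%C)).
  - apply Ccv_sesqui. intros x y. set (m := (d y - d x + 1)%Z).
    apply Ccv_ext with (fun N =>
      mean (S N) (fun t => f (r * cis t) * cis (- IZR m * t))%C
      + (-1) * mean (S N) (fun t => f (s * cis t) * cis (- IZR m * t)))%C.
    + intros N. rewrite <- mean_scal, <- mean_plus. apply mean_ext. intros t.
      unfold F. replace (- IZR m * t) with (- t + - IZR (d y - d x) * t)
        by (unfold m; rewrite plus_IZR; ring).
      rewrite cis_plus. ring.
    + replace (_ - _)%C with (Zcoef (fun j => a j * r ^ j)%C m
        + (-1) * Zcoef (fun j => a j * s ^ j)%C m)%C by ring.
      apply Ccv_plus; [|apply Ccv_scal]; apply mean_tends_to_coefficient; trivial; lra.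
  - exists O. intros N _. rewrite <- mean_square_weight.
    apply Re_mean_ge0; [lia|]. intros t.
    rewrite <- Cmod2_conj, re_scal_r. apply Rmult_le_pos.
    + now apply radial_increase.
    + apply pow2_ge_0.
Qed.

(** Induction through
    [(r^(k+1) - s^(k+1)) / (r - s) = r * ((r^k - s^k) / (r - s)) + s^k]. *)
Lemma power_slope_limit (r s : nat -> R) (k : nat) :
  (forall N, r N <> s N) -> is_lim_seq r 1 -> is_lim_seq s 1 ->
  is_lim_seq (fun N => (r N ^ k - s N ^ k) / (r N - s N)) (INR k).
Proof.
  intros Hn Hr Hs. induction k as [|k IH].
  - apply is_lim_seq_ext with (fun _ => 0); [|apply is_lim_seq_const].
    intros N. simpl. specialize (Hn N). field. lra.
  - apply is_lim_seq_ext with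
      (fun N => r N * ((r N ^ k - s N ^ k) / (r N - s N)) + s N ^ k).
    + intros N. simpl. specialize (Hn N). field. lra.
    + rewrite S_INR. apply is_lim_seq_plus'.
      * replace (INR k) with (1 * INR k) by ring. now apply is_lim_seq_mult'.
      * clear IH. induction k as [|k IH]; simpl; [apply is_lim_seq_const|].
        replace (Finite 1) with (Finite (1 * 1)) by (f_equal; ring).
        now apply is_lim_seq_mult'.
Qed.

(** The Toeplitz form of [f'] is nonnegative: divide the increment form by
    [r - s] and let both radii tend to [1]. The limit of the slopes is what
    produces the coefficients [j * a j] of [f']. *)
Lemma toeplitz_form_ge0 (f : C -> C) (a : nat -> C)
    (n : nat) (lam : nat -> C) (d : nat -> Z) :
  class_R f ->
  (forall z, unit_disk z -> @is_pseries C_AbsRing C_NormedModule a z (f z)) ->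
  0 <= Re (sesqui n lam (fun x y =>
    Zcoef (fun j => INR j * a j)%C (d y - d x + 1))).
Proof.
  intros Hf Ha.
  (* Two sequences tending to [1] with [0 <= s N < r N < 1] for every [N]. *)
  set (r := fun N => 1 - / 2 * / INR (S N)). set (s := fun N => 1 - / INR (S N)).
  assert (Hinv : forall N, 0 < / INR (S N) <= 1).
  { intros N. split; [apply Rinv_0_lt_compat, lt_0_INR; lia|].
    rewrite <- Rinv_1. apply Rinv_le_contravar; [lra|]. apply (le_INR 1). lia. }
  assert (Hi : is_lim_seq (fun N => / INR (S N)) 0).
  { apply (is_lim_seq_incr_1 (fun N => / INR N)).
    replace (Finite 0) with (Rbar_inv p_infty) by easy.
    apply is_lim_seq_inv; [apply is_lim_seq_INR|easy]. }
  assert (Hr1 : is_lim_seq r 1).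
  { replace (Finite 1) with (Finite (1 - / 2 * 0)) by (f_equal; ring).
    apply is_lim_seq_minus'; [apply is_lim_seq_const|].
    apply is_lim_seq_mult'; [apply is_lim_seq_const|easy]. }
  assert (Hs1 : is_lim_seq s 1).
  { replace (Finite 1) with (Finite (1 - 0)) by (f_equal; ring).
    apply is_lim_seq_minus'; [apply is_lim_seq_const|easy]. }
  assert (Hsr : forall N, 0 <= s N < r N /\ r N < 1).
  { intros N. specialize (Hinv N). unfold r, s. lra. }
  apply Ccv_Re_ge0 with (fun N => sesqui n lam (fun x y =>
    (/ (r N - s N))%R * (Zcoef (fun j => a j * r N ^ j)%C (d y - d x + 1)
    - Zcoef (fun j => a j * s N ^ j)%C (d y - d x + 1)))%C).
  - apply Ccv_sesqui. intros x y. unfold Zcoef.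
    destruct (Z.ltb (d y - d x + 1) 0).
    + apply Ccv_ext with (fun _ => RtoC 0); [intros N; ring|apply Ccv_const].
    + set (k := Z.to_nat _).
      apply Ccv_ext with (fun N => a k * RtoC ((r N ^ k - s N ^ k) / (r N - s N)))%C.
      * intros N. unfold Rdiv.
        rewrite RtoC_mult, RtoC_minus, !RtoC_pow. ring.
      * rewrite (Cmult_comm (INR k)). apply Ccv_scal, Ccv_RtoC, power_slope_limit; trivial.
        intros N. specialize (Hsr N). lra.
  - exists O. intros N _. destruct (Hsr N) as [H1 H2].
    rewrite sesqui_scal, re_scal_l. apply Rmult_le_pos.
    + left. apply Rinv_0_lt_compat. lra.
    + now apply (difference_form_ge0 f).
Qed.

(** * Coefficient bodies of functions with derivative of positive real part *)

Definition deriv_coef (a : nat -> C) (k : nat) : C := (INR (S k) * a (S k))%C.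

(** The Toeplitz form at the frequencies [0], [i] and [i + k]. A diagonal entry
    is the constant term [1] of [f'], and the entries on one side of the diagonal vanish,
    [f'] being analytic; hence each off-diagonal pair contributes a single term. *)
Lemma three_frequency_form_ge0 (f : C -> C) (a : nat -> C) (i k : nat) (u v w : C) :
  class_R f -> normalized_expansion f a -> (0 < i)%nat -> (0 < k)%nat ->
  0 <= Cmod u ^ 2 + Cmod v ^ 2 + Cmod w ^ 2
    + Re (u * Cconj v * deriv_coef a i + v * Cconj w * deriv_coef a k
          + u * Cconj w * deriv_coef a (i + k))%C.
Proof.
  intros Hf [_ [Ha1 Ha]] Hi Hk.
  set (lam := fun x => match x with O => u | 1%nat => v | _ => w end).
  set (d := fun x => match x with O => 0%Z | 1%nat => Z.of_nat i | _ => Z.of_nat (i + k) end).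
  pose proof (toeplitz_form_ge0 f a 3 lam d Hf Ha) as H.
  set (c := Zcoef (fun j => INR j * a j)%C) in H.
  assert (H0 : c 1%Z = 1).
  { change (INR 1 * a 1%nat = 1)%C. rewrite Ha1. simpl INR. ring. }
  assert (Hp : forall j, c (Z.of_nat j + 1)%Z = deriv_coef a j).
  { intros j. unfold c, Zcoef, deriv_coef. destruct (Z.ltb_spec (Z.of_nat j + 1) 0); [lia|].
    now replace (Z.to_nat (Z.of_nat j + 1)) with (S j) by lia. }
  assert (Hneg : forall m, (m <= 0)%Z -> c m = 0).
  { intros m Hm. unfold c, Zcoef. destruct (Z.ltb_spec m 0); [easy|].
    replace (Z.to_nat m) with O by lia. simpl INR. ring. }
  unfold sesqui in H. cbn [Csum lam d] in H.
  replace (0 - 0 + 1)%Z with 1%Z in H by lia.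
  replace (Z.of_nat i - Z.of_nat i + 1)%Z with 1%Z in H by lia.
  replace (Z.of_nat (i + k) - Z.of_nat (i + k) + 1)%Z with 1%Z in H by lia.
  replace (Z.of_nat (i + k) - Z.of_nat i + 1)%Z with (Z.of_nat k + 1)%Z in H by lia.
  rewrite !Z.sub_0_r, !Hp, !H0 in H.
  rewrite !Hneg in H by lia.
  apply Rle_trans with (1 := H). apply Req_le.
  rewrite !Cmod2_alt. unfold Re, Im. simpl. ring.
Qed.

(** The hypothesis says that the Hermitian matrix with unit diagonal and
    off-diagonal entries [al], [be], [ga] is positive semidefinite. Completing
    the square in the middle variable leaves a form in two variables whose
    discriminant is the stated inequality. *)
Lemma minor_bound (al be ga : C) :
  (forall u v w, 0 <= Cmod u ^ 2 + Cmod v ^ 2 + Cmod w ^ 2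
    + 2 * Re (u * Cconj v * al + v * Cconj w * be + u * Cconj w * ga)%C) ->
  Cmod al <= 1 /\ Cmod be <= 1 /\
  Cmod (ga - al * be) ^ 2 <= (1 - Cmod al ^ 2) * (1 - Cmod be ^ 2).
Proof.
  intros H.
  set (A := 1 - Cmod al ^ 2). set (B := 1 - Cmod be ^ 2).
  set (de := (ga - al * be)%C). set (D := Cmod de ^ 2).
  (* [v] is chosen to minimise the form for given [u] and [w]. *)
  assert (Hred : forall u w,
    0 <= Cmod u ^ 2 * A + Cmod w ^ 2 * B + 2 * Re (u * Cconj w * de)%C).
  { intros u w. apply Rle_trans with (1 := H u (- (u * al + w * Cconj be))%C w).
    apply Req_le. unfold A, B, de. rewrite !Cmod2_alt. unfold Re, Im. simpl. ring. }
  (* The phase of [u] aligns the mixed term with the real axis. *)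
  assert (Hform : forall t s : R, 0 <= t ^ 2 * D * A + s ^ 2 * B + 2 * t * s * D).
  { intros t s. apply Rle_trans with (1 := Hred (t * Cconj de)%C (RtoC s)).
    apply Req_le. unfold D. rewrite !Cmod2_alt. unfold Re, Im. simpl. ring. }
  assert (HA : 0 <= A).
  { generalize (Hred 1 0). rewrite Cmod_1, Cmod_0. unfold Re. simpl. lra. }
  assert (HB : 0 <= B).
  { generalize (Hred 0 1). rewrite Cmod_1, Cmod_0. unfold Re. simpl. lra. }
  pose proof (Cmod_ge_0 al). pose proof (Cmod_ge_0 be).
  split; [|split].
  - unfold A in HA. nra.
  - unfold B in HB. nra.
  - assert (HD : 0 <= D) by apply pow2_ge_0.
    destruct (Rle_lt_or_eq_dec _ _ HA) as [HA'|HA'].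
    + generalize (Hform 1 (- A)). intros HF.
      apply Rmult_le_reg_l with A; [easy|]. nra.
    (* With [A = 0] the form is affine in [t], so its slope must vanish. *)
    + rewrite <- HA'. apply Rnot_lt_le. intros HD'.
      generalize (Hform (- (B + 1) / D) 1). rewrite <- HA'.
      replace (2 * (- (B + 1) / D) * 1 * D) with (- 2 * (B + 1)) by (field; lra). lra.
Qed.

(** Halving the coefficients accounts for the analytic Toeplitz matrix having
    entries on one side of the diagonal only: its Hermitian part carries half of
    each. *)
Lemma caratheodory_minor_bound (f : C -> C) (a : nat -> C) (i k : nat) :
  class_R f -> normalized_expansion f a -> (0 < i)%nat -> (0 < k)%nat ->
  let b j := (deriv_coef a j / 2)%C in
  Cmod (b i) <= 1 /\ Cmod (b k) <= 1 /\
  Cmod (b (i + k)%nat - b i * b k) ^ 2 <= (1 - Cmod (b i) ^ 2) * (1 - Cmod (b k) ^ 2).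
Proof.
  intros Hf Ha Hi Hk b. apply minor_bound. intros u v w.
  rewrite <- re_scal_l.
  replace (2 * (u * Cconj v * b i + v * Cconj w * b k + u * Cconj w * b (i + k)%nat))%C
    with (u * Cconj v * deriv_coef a i + v * Cconj w * deriv_coef a k
          + u * Cconj w * deriv_coef a (i + k))%C.
  - now apply (three_frequency_form_ge0 f).
  - unfold b. field.
Qed.

(** * The Hankel determinant *)

Lemma Rle_of_sqr_le (z t : R) : 0 <= t -> z ^ 2 <= t * t -> z <= t.
Proof. intros Ht H. apply Rnot_lt_le. intros Hz. nra. Qed.

(** The normalised coefficients [b j] of [f'] are recentred so that each defect
    [e2], [e3], [e4] is controlled by a three-frequency minor. Substituting
    [b 4 = e4 + b 2 ^ 2] and [b 3 = e3 + b 1 * b 2] makes most of the terms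
    free of defects cancel: only small multiples of [b 1 ^ 2 * b 2 ^ 2] and
    [b 2 ^ 3] survive. *)
Lemma hankel_decomposition (a : nat -> C) :
  a 1%nat = 1 ->
  let b j := (deriv_coef a j / 2)%C in
  let e4 := (b 4%nat - b 2%nat * b 2%nat)%C in
  let e3 := (b 3%nat - b 1%nat * b 2%nat)%C in
  let e2 := (b 2%nat - b 1%nat * b 1%nat)%C in
  hankel_3_1 a =
    ((4 / 15)%R * ((e2 - (1 / 2)%R * (b 1%nat * b 1%nat)) * e4)
     - (1 / 4)%R * (e3 * e3)
     + (1 / 6)%R * (b 1%nat * b 2%nat * e3)
     + (1 / 60)%R * (b 1%nat * b 2%nat * (b 1%nat * b 2%nat))
     - (4 / 135)%R * (b 2%nat * b 2%nat * b 2%nat))%C.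
Proof.
  intros H1. cbv zeta. unfold hankel_3_1, det3, deriv_coef. rewrite H1.
  rewrite !RtoC_div by lra. cbn [INR].
  rewrite !RtoC_plus. field.
Qed.

Theorem corollary3p2 (f : C -> C) (a : nat -> C)
    (hf : class_R f) (ha : normalized_expansion f a) :
  (Cmod (hankel_3_1 a) <= 993 / 1620)%R.
Proof.
  rewrite hankel_decomposition by apply ha. cbv zeta.
  destruct (caratheodory_minor_bound f a 1 1 hf ha) as (Hx & _ & H2); [lia..|].
  destruct (caratheodory_minor_bound f a 1 2 hf ha) as (_ & Hy & H3); [lia..|].
  destruct (caratheodory_minor_bound f a 2 2 hf ha) as (_ & _ & H4); [lia..|].
  cbv zeta in *. cbn [Nat.add] in *.
  set (b1 := (deriv_coef a 1 / 2)%C) in *. set (b2 := (deriv_coef a 2 / 2)%C) in *.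
  set (b3 := (deriv_coef a 3 / 2)%C) in *. set (b4 := (deriv_coef a 4 / 2)%C) in *.
  set (e2 := (b2 - b1 * b1)%C) in *. set (e3 := (b3 - b1 * b2)%C) in *.
  set (e4 := (b4 - b2 * b2)%C) in *.
  pose proof (Cmod_ge_0 b1) as Hx0. pose proof (Cmod_ge_0 b2) as Hy0.
  pose proof (Cmod_ge_0 e3) as Hz0.
  apply Rle_of_sqr_le in H2; [|nra]. apply Rle_of_sqr_le in H4; [|nra].
  assert (Htri : forall p q, Cmod (p - q) <= Cmod p + Cmod q).
  { intros p q. unfold Cminus. rewrite <- (Cmod_opp q). apply Cmod_triangle. }
  assert (Hs : forall (c : R) p, 0 <= c -> Cmod (c * p) = c * Cmod p).
  { intros c p Hc. now rewrite Cmod_mult, Cmod_R, Rabs_pos_eq. }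
  (* [Cmod e2 <= 1 - x ^ 2] leaves room for the extra [x ^ 2 / 2]. *)
  assert (Hg : Cmod (e2 - (1 / 2)%R * (b1 * b1)) <= 1).
  { apply Rle_trans with (1 := Htri _ _). rewrite Hs, Cmod_mult by lra. nra. }
  apply Rle_trans with (1 := Htri _ _).
  apply Rle_trans with
    (4 / 15 * (Cmod (e2 - (1 / 2)%R * (b1 * b1)) * Cmod e4)
     + 1 / 4 * (Cmod e3 * Cmod e3)
     + 1 / 6 * (Cmod b1 * Cmod b2 * Cmod e3)
     + 1 / 60 * (Cmod b1 * Cmod b2 * (Cmod b1 * Cmod b2))
     + 4 / 135 * (Cmod b2 * Cmod b2 * Cmod b2)).
  { rewrite <- !Cmod_mult, <- !Hs by lra. apply Rplus_le_compat_r.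
    apply Rle_trans with (1 := Cmod_triangle _ _). apply Rplus_le_compat_r.
    apply Rle_trans with (1 := Cmod_triangle _ _). apply Rplus_le_compat_r.
    apply Htri. }
  set (x := Cmod b1) in *. set (y := Cmod b2) in *. set (z := Cmod e3) in *.
  (* Everything is reduced to [y]: the large terms carry the factor
     [1 - y ^ 2], with total weight [3 / 5], and the others carry [y ^ 2] with
     weight [1 / 12 + 1 / 60 + 4 / 135], which is smaller. *)
  assert (T1 : Cmod (e2 - (1 / 2)%R * (b1 * b1)) * Cmod e4 <= 1 - y ^ 2).
  { apply Rle_trans with (2 := H4). rewrite <- (Rmult_1_l (Cmod e4)) at 2.
    apply Rmult_le_compat_r; [apply Cmod_ge_0|easy]. }
  assert (Hx2 : 0 <= x ^ 2 <= 1) by nra. assert (Hy2 : 0 <= y ^ 2 <= 1) by nra.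
  assert (T2 : z * z <= 1 - y ^ 2).
  { replace (z * z) with (z ^ 2) by ring. apply Rle_trans with (1 := H3). nra. }
  assert (T3 : 2 * (x * y * z) <= x * y * (x * y) + z * z).
  { pose proof (pow2_ge_0 (x * y - z)). nra. }
  assert (T4 : x * y * (x * y) <= y ^ 2).
  { replace (x * y * (x * y)) with (x ^ 2 * y ^ 2) by ring. nra. }
  assert (T5 : y * y * y <= y ^ 2).
  { replace (y * y * y) with (y ^ 2 * y) by ring. nra. }
  lra.
Qed.
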